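(* Consider a solution candidate of positive elliptic form, i.e. functions $w_i=r_i(t)\cos[\alpha(t)+a_i]$, $x_i=r_i(t)\sin[\alpha(t)+a_i]$, $y_i=y_i(t)$, $z_i=z_i(t)$, $i=1,\dots,N$, with $a_i$ constants, $\alpha$ nonconstant, $0\le r_i\le 1$, $-1\le y_i,z_i\le1$ and $r_i^2+y_i^2+z_i^2=1$. It is a positive elliptic rotopulsator of the curved $N$-body problem in $\mathbb S^3$ if and only if $$\dot\alpha=\frac{c}{\sum_{j=1}^Nm_jr_j^2},$$ where $c\neq0$ is a constant, there are at least two distinct indices $i,j$ such that $q_{ij}$ is not constant, and the variables $y_i,z_i,r_i$, $i=1,\dots,N$, satisfy the first-order system of $5N$ equations (with the $N$ constraints $r_i^2+y_i^2+z_i^2=1$) $$\begin{cases}\dot y_i=u_i\\ \dot z_i=v_i\\ \dot u_i=\sum_{j\ne i}\frac{m_j(y_j-q_{ij}y_i)}{(1-q_{ij}^2)^{3/2}}-F_i(\mathbf y,\mathbf z,u_i,v_i)\,y_i\\ \dot v_i=\sum_{j\ne i}\frac{m_j(z_j-q_{ij}z_i)}{(1-q_{ij}^2)^{3/2}}-F_i(\mathbf y,\mathbf z,u_i,v_i)\,z_i\\ r_i\ddot\alpha+2\dot r_i\dot\alpha=\sum_{j\ne i}\frac{m_jr_j\sin(a_j-a_i)}{(1-q_{ij}^2)^{3/2}},\end{cases}$$ $i=1,\dots,N$, where $\mathbf y=(y_1,\dots,y_N)$, $\mathbf z=(z_1,\dots,z_N)$, $$F_i(\mathbf y,\mathbf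 z,u_i,v_i):=\frac{u_i^2+v_i^2-(y_iv_i-z_iu_i)^2}{1-y_i^2-z_i^2}+\frac{c^2(1-y_i^2-z_i^2)}{\big[\sum_{j=1}^Nm_j(1-y_j^2-z_j^2)\big]^2},$$ and, for any $i,j\in\{1,\dots,N\}$, $q_{ij}=r_ir_j\cos(a_i-a_j)+y_iy_j+z_iz_j$. If (the other conditions holding) the quantities $q_{ij}$ are constant for all distinct $i,j$, then the solution is a positive elliptic relative equilibrium. If $q_{ij}=\pm1$ for some distinct $i,j$, then such solutions do not exist.
   Context: Masses $m_1,\dots,m_N>0$, $N\ge 2$; dots denote $d/dt$; $\sum_{j\ne i}$ runs over $j\in\{1,\dots,N\}\setminus\{i\}$. $\mathbb S^3=\{(w,x,y,z)\in\mathbb R^4: w^2+x^2+y^2+z^2=1\}$, $\cdot$ is the standard inner product, $\mathbf q_i=(w_i,x_i,y_i,z_i)$, $q_{ij}:=\mathbf q_i\cdot\mathbf q_j$, $\dot q_{ii}:=\dot{\mathbf q}_i\cdot\dot{\mathbf q}_i$. The curved $N$-body problem in $\mathbb S^3$ is the system $$\ddot{\mathbf q}_i=\sum_{j\ne i}\frac{m_j(\mathbf q_j-q_{ij}\mathbf q_i)}{(1-q_{ij}^2)^{3/2}}-\dot q_{ii}\mathbf q_i,\quad q_{ii}=1,\quad i=1,\dots,N.$$ A positive elliptic rotopulsator is a solution of this system of the positive elliptic form described in the claim for which there are at least two indices $i\ne j$ with $q_{ij}$ not constant; if instead all $q_{ij}$, $i\neq j$, are constant, the solution is called a positive elliptic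 relative equilibrium.
   Formalization: The equivalence is proved assuming 1-y_i^2-z_i^2 (that is, r_i^2) never vanishes, since F_i is undefined where r_i=0 and the claim fails there (e.g. all r_i=0); the functions are taken twice differentiable on an open time interval. *)

(* Defs.v *)
From HB Require Import structures.
From mathcomp Require Import all_boot all_order all_algebra.
From mathcomp Require Import all_classical all_reals all_analysis.

Set Implicit Arguments.
Unset Strict Implicit.
Unset Printing Implicit Defensive.

Import Order.TTheory GRing.Theory Num.Theory.
Import numFieldNormedType.Exports.

Local Open Scope ring_scope.
Local Open Scope classical_set_scope.

Definition is_open_interval (R : realType) (I : set R) : Prop :=
  [/\ open I, is_interval I & I !=set0].

Definition is_const_on (R : realType) (T : Type) (I : set R) (f : R -> T) :
    Prop :=
  forall s t : R, I s -> I t -> f s = f t.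

Definition twice_derivable_on (R : realType) (V : normedModType R)
    (I : set R) (f : R -> V) : Prop :=
  forall t : R, I t -> derivable f t 1 /\ derivable f^`() t 1.

Definition dot (R : realType) (n : nat) (p q : 'rV[R]_n) : R :=
  \sum_k p 0 k * q 0 k.

(* (1 - q^2)^{3/2} *)
Definition grav_den (R : realType) (q : R) : R := (1 - q ^+ 2) `^ (3 / 2).

(* Division is total in the library (x / 0 = 0), so the requirement that the
   right-hand side be defined, i.e. that the configuration avoid the singular
   set q_ij = 1 or q_ij = -1, is an explicit clause. *)
Definition solves_curved_nbody (R : realType) (N : nat) (I : set R)
    (m : 'I_N -> R) (q : 'I_N -> R -> 'rV[R]_4) : Prop :=
  [/\ forall i, twice_derivable_on I (q i),
      forall i t, I t -> dot (q i t) (q i t) = 1,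
      forall i j t, i != j -> I t -> 1 - dot (q i t) (q j t) ^+ 2 != 0 &
      forall i t, I t ->
        (q i)^`(2) t =
          \sum_(j | j != i) (m j / grav_den (dot (q i t) (q j t))) *:
             (q j t - dot (q i t) (q j t) *: q i t)
          - dot ((q i)^`()%classic t) ((q i)^`()%classic t) *: q i t].

Definition elliptic_curve (R : realType) (N : nat) (a : 'I_N -> R)
    (alpha : R -> R) (r y z : 'I_N -> R -> R) (i : 'I_N) (t : R) : 'rV[R]_4 :=
  \row_k [:: r i t * cos (alpha t + a i); r i t * sin (alpha t + a i);
             y i t; z i t]`_k.

(* The coordinate functions of a candidate solution of a second-order system
   are taken to be twice differentiable. *)
Definition elliptic_candidate (R : realType) (N : nat) (I : set R)
    (alpha : R -> R) (r y z : 'I_N -> R -> R) : Prop :=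
  [/\ twice_derivable_on I alpha,
      forall i, [/\ twice_derivable_on I (r i), twice_derivable_on I (y i) &
                    twice_derivable_on I (z i)],
      ~ is_const_on I alpha &
      forall i t, I t ->
        [/\ 0 <= r i t <= 1, -1 <= y i t <= 1, -1 <= z i t <= 1 &
            r i t ^+ 2 + y i t ^+ 2 + z i t ^+ 2 = 1]].

Definition positive_elliptic_form (R : realType) (N : nat) (I : set R)
    (q : 'I_N -> R -> 'rV[R]_4) : Prop :=
  exists (a : 'I_N -> R) (alpha : R -> R) (r y z : 'I_N -> R -> R),
    elliptic_candidate I alpha r y z /\
    forall i t, I t -> q i t = elliptic_curve a alpha r y z i t.

Definition positive_elliptic_rotopulsator (R : realType) (N : nat) (I : set R)
    (m : 'I_N -> R) (q : 'I_N -> R -> 'rV[R]_4) : Prop :=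
  [/\ solves_curved_nbody I m q, positive_elliptic_form I q &
      exists i j, i != j /\ ~ is_const_on I (fun t => dot (q i t) (q j t))].

Definition positive_elliptic_relative_equilibrium (R : realType) (N : nat)
    (I : set R) (m : 'I_N -> R) (q : 'I_N -> R -> 'rV[R]_4) : Prop :=
  [/\ solves_curved_nbody I m q, positive_elliptic_form I q &
      forall i j, i != j -> is_const_on I (fun t => dot (q i t) (q j t))].

Definition elliptic_q (R : realType) (N : nat) (a : 'I_N -> R)
    (r y z : 'I_N -> R -> R) (i j : 'I_N) (t : R) : R :=
  r i t * r j t * cos (a i - a j) + y i t * y j t + z i t * z j t.

Definition elliptic_F (R : realType) (N : nat) (m : 'I_N -> R) (c : R)
    (i : 'I_N) (y z : 'I_N -> R) (u v : R) : R :=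
  (u ^+ 2 + v ^+ 2 - (y i * v - z i * u) ^+ 2) / (1 - y i ^+ 2 - z i ^+ 2)
  + c ^+ 2 * (1 - y i ^+ 2 - z i ^+ 2)
    / (\sum_j m j * (1 - y j ^+ 2 - z j ^+ 2)) ^+ 2.

(* On the constraint set the denominator 1 - y_i^2 - z_i^2 equals r_i^2, so this
   says that the quotients in F_i make sense, i.e. that no r_i vanishes. *)
Definition F_defined_on (R : realType) (N : nat) (I : set R)
    (y z : 'I_N -> R -> R) : Prop :=
  forall i t, I t -> 1 - y i t ^+ 2 - z i t ^+ 2 != 0.

(* The first two clauses say that the quotients in the equations are defined;
   u and v are the auxiliary velocity variables of the first-order form. *)
Definition elliptic_system (R : realType) (N : nat) (I : set R)
    (m a : 'I_N -> R) (c : R) (alpha : R -> R) (r y z : 'I_N -> R -> R) : Prop :=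
  let q := elliptic_q a r y z in
  [/\ forall i j t, i != j -> I t -> 1 - q i j t ^+ 2 != 0,
      F_defined_on I y z &
      exists u v : 'I_N -> R -> R, forall i t, I t ->
        let F := elliptic_F m c i (y^~ t) (z^~ t) (u i t) (v i t) in
        [/\ is_derive t 1 (y i) (u i t),
            is_derive t 1 (z i) (v i t),
            is_derive t 1 (u i)
              (\sum_(j | j != i) m j * (y j t - q i j t * y i t)
                                  / grav_den (q i j t) - F * y i t),
            is_derive t 1 (v i)
              (\sum_(j | j != i) m j * (z j t - q i j t * z i t)
                                  / grav_den (q i j t) - F * z i t) &
            r i t * alpha^`(2)%classic t
            + 2 * (r i)^`()%classic t * alpha^`()%classic t =
              \sum_(j | j != i) m j * r j t * sin (a j - a i)
                                  / grav_den (q i j t)]].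

Definition elliptic_angle_law (R : realType) (N : nat) (I : set R)
    (m : 'I_N -> R) (c : R) (alpha : R -> R) (r : 'I_N -> R -> R) : Prop :=
  forall t, I t -> is_derive t 1 alpha (c / \sum_j m j * r j t ^+ 2).

(* Main.v *)
Require Import Defs.
From HB Require Import structures.
From mathcomp Require Import all_boot all_order all_algebra.
From mathcomp Require Import all_classical all_reals all_analysis.
From mathcomp Require Import ring lra.
Set Implicit Arguments.
Unset Strict Implicit.
Unset Printing Implicit Defensive.

Import Order.TTheory GRing.Theory Num.Theory.
Import numFieldNormedType.Exports.
Local Open Scope ring_scope.
Local Open Scope classical_set_scope.

(** In the moving frame with angle [alpha + a i] the equation of motion of body
    [i] splits into a radial, an angular, a y- and a z-component. Differentiating
    [r^2 + y^2 + z^2 = 1] twice shows that, as long as [r] does not vanish, the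
    radial component follows from the y- and z-components. The angular components,
    weighted by [m i * r i] and summed, cancel by antisymmetry, so the angular
    momentum [\sum_i m i * r i ^+ 2 * alpha'] is a constant [c], which is nonzero
    because [alpha] is not constant; eliminating [alpha'] and [r'] turns the squared
    speed of body [i] into [F_i]. *)

(** * Differentiation rules for pointwise products, sums, phase shifts and matrices *)

Lemma is_derive_mulfun (R : realType) (f g : R -> R) (t df dg : R) :
  is_derive t 1 f df -> is_derive t 1 g dg ->
  is_derive t 1 (fun s => f s * g s) (df * g t + f t * dg).
Proof.
move=> hf hg; have h := is_deriveM hf hg.
apply: (@is_derive_eq _ _ _ (f * g) _ _ _ _ h).
by rewrite /GRing.scale /= addrC mulrC.
Qed.

Lemma is_derive_addfun (R : realType) (f g : R -> R) (t df dg : R) :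
  is_derive t 1 f df -> is_derive t 1 g dg ->
  is_derive t 1 (fun s => f s + g s) (df + dg).
Proof. by move=> hf hg; have := is_deriveD hf hg. Qed.

Lemma is_derive_oppfun (R : realType) (f : R -> R) (t df : R) :
  is_derive t 1 f df -> is_derive t 1 (fun s => - f s) (- df).
Proof. by move=> hf; have := is_deriveN hf. Qed.

Lemma is_derive_cos_shift (R : realType) (f : R -> R) (b t df : R) :
  is_derive t 1 f df ->
  is_derive t 1 (fun s => cos (f s + b)) (- (df * sin (f t + b))).
Proof.
move=> hf; have hb : is_derive t 1 (fun s => f s + b) df.
  by have := is_derive_addfun hf (is_derive_cst b t 1); rewrite addr0.
have := @is_derive1_comp R _ (fun s => f s + b) t _ _ (is_derive_cos (f t + b)) hb.
by rewrite mulNr mulrC.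
Qed.

Lemma is_derive_sin_shift (R : realType) (f : R -> R) (b t df : R) :
  is_derive t 1 f df ->
  is_derive t 1 (fun s => sin (f s + b)) (df * cos (f t + b)).
Proof.
move=> hf; have hb : is_derive t 1 (fun s => f s + b) df.
  by have := is_derive_addfun hf (is_derive_cst b t 1); rewrite addr0.
have := @is_derive1_comp R _ (fun s => f s + b) t _ _ (is_derive_sin (f t + b)) hb.
by rewrite mulrC.
Qed.

Lemma is_derive_mx (R : realType) (p n : nat) (M : R -> 'M[R]_(p, n))
    (t : R) (dM : 'M[R]_(p, n)) :
  (forall i j, is_derive t 1 (fun s => M s i j) (dM i j)) -> is_derive t 1 M dM.
Proof.
move=> h; have dermx : derivable M t 1.
  by apply/derivable_mxP => i j; exact: ex_derive.
by split=> //; rewrite derive_mx //; apply/matrixP => i j; rewrite mxE derive_val.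
Qed.

Lemma derive1_is_derive (R : realType) (V : normedModType R) (f : R -> V)
    (t : R) (df : V) : is_derive t 1 f df -> f^`() t = df.
Proof. by move=> [_ <-]; rewrite derive1E. Qed.

(** * Derivatives and constancy on open sets and intervals *)

Section OpenSet.
Context (R : realType) (V : normedModType R) (I : set R) (oI : open I).

(** Openness turns equality on [I] into equality near [t], which is all that a derivative at [t]
    depends on. *)
Lemma is_derive_eq_on (f g : R -> V) (t : R) (df : V) :
  I t -> (forall s, I s -> f s = g s) -> is_derive t 1 f df ->
  is_derive t 1 g df.
Proof.
move=> It fg; apply: near_eq_is_derive.
by apply: filterS (open_nbhs_nbhs (conj oI It)) => s /fg.
Qed.

Lemma twice_derivable_onP (f f1 f2 : R -> V) :
  (forall t, I t -> is_derive t 1 f (f1 t)) ->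
  (forall t, I t -> is_derive t 1 f1 (f2 t)) ->
  [/\ twice_derivable_on I f, forall t, I t -> f^`() t = f1 t &
      forall t, I t -> f^`(2) t = f2 t].
Proof.
move=> h1 h2.
have e1 t : I t -> f^`() t = f1 t by move=> It; exact: derive1_is_derive (h1 t It).
have d2 t : I t -> is_derive t 1 f^`() (f2 t).
  by move=> It; apply: (@is_derive_eq_on f1) => // [s Is|]; [rewrite e1 | exact: h2].
split=> // t It.
  by have [? _] := h1 t It; have [] := d2 t It.
by rewrite derive1nS derive1n1; exact: derive1_is_derive (d2 t It).
Qed.

Lemma twice_derivable_onE (f : R -> V) : twice_derivable_on I f ->
  forall t, I t -> is_derive t 1 f (f^`() t) /\ is_derive t 1 f^`() (f^`(2) t).
Proof.
move=> h t It; have [h1 h2] := h t It.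
rewrite derive1nS derive1n1 !derive1E.
by split; apply: DeriveDef => //; rewrite derive1E.
Qed.

End OpenSet.

Lemma derive_const_on (R : realType) (I : set R) (f : R -> R) (t c df : R) :
  open I -> I t -> (forall s, I s -> f s = c) -> is_derive t 1 f df -> df = 0.
Proof.
move=> oI It fc /(@is_derive_eq_on R R I oI f (cst c) t df It fc).
by move/derive1_is_derive => <-; rewrite derive1_cst.
Qed.

(** Mean value theorem on the segment joining the two points, which stays in [I] because [I] is an
    interval. *)
Lemma derive0_const_on (R : realType) (I : set R) (f : R -> R) :
  is_interval I -> (forall t, I t -> is_derive t 1 f 0) -> is_const_on I f.
Proof.
move=> iI hf.
suff le s t : I s -> I t -> s <= t -> f s = f t.
  move=> s t Is It; have [st|/ltW ts] := leP s t; first exact: le.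
  by apply/esym/le.
move=> Is It st.
have sub x : s <= x <= t -> I x by exact: iI.
have cf : {within `[s, t], continuous f}.
  apply: continuous_in_subspaceT => x; rewrite inE /= in_itv /= => /sub Ix.
  by apply/differentiable_continuous/derivable1_diffP; by case: (hf x Ix).
have [|_ _ ] := MVT_segment (f := f) (df := fun=> 0) st _ cf.
  move=> x; rewrite in_itv /= => /andP[sx xt].
  by apply/hf/sub; rewrite !ltW.
by rewrite mul0r => /eqP; rewrite subr_eq0 => /eqP.
Qed.

(** * Coordinates in four-space and the rotated frame *)

Definition row4 (R : realType) (a b c d : R) : 'rV[R]_4 :=
  \row_k [:: a; b; c; d]`_k.

Lemma row4P (R : realType) (a b c d a' b' c' d' : R) :
  row4 a b c d = row4 a' b' c' d' <-> [/\ a = a', b = b', c = c' & d = d'].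
Proof.
split=> [/rowP h|[-> -> -> ->] //].
have := h 0; have := h 1; have := h 2%:R; have := h 3%:R.
by rewrite !mxE /=.
Qed.

Lemma dot_row4 (R : realType) (a b c d a' b' c' d' : R) :
  dot (row4 a b c d) (row4 a' b' c' d') = a * a' + b * b' + c * c' + d * d'.
Proof.
by rewrite /dot !big_ord_recl big_ord0 !mxE /= addr0 !addrA.
Qed.

(** The two hypotheses compare images under the rotation by [th]; [hA] and [hB] recover the
    coordinates by applying the inverse rotation. *)
Lemma rotation_inj (R : realType) (th A B A' B' : R) :
  A * cos th - B * sin th = A' * cos th - B' * sin th ->
  A * sin th + B * cos th = A' * sin th + B' * cos th -> A = A' /\ B = B'.
Proof.
move=> e1 e2; have cs := cos2Dsin2 th.
have hA X Y : X = cos th * (X * cos th - Y * sin th)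
                 + sin th * (X * sin th + Y * cos th).
  by rewrite -[LHS]mulr1 -cs; ring.
have hB X Y : Y = cos th * (X * sin th + Y * cos th)
                 - sin th * (X * cos th - Y * sin th).
  by rewrite -[LHS]mulr1 -cs; ring.
by split; [rewrite (hA A B) (hA A' B') e1 e2 | rewrite (hB A B) (hB A' B') e1 e2].
Qed.

(** Writing [th j] as [th i + (th j - th i)] exhibits the planar part of the force as the rotation
    by [th i] of a radial and a transverse component, and [rotation_inj] removes the rotation. Since
    [p i] is purely radial in this frame, the [Q] and [K] terms are absent from the equation for
    [B]. *)
Lemma elliptic_newtonP (R : realType) (N : nat) (b Q th r y z : 'I_N -> R)
    (i : 'I_N) (A B C D K : R) :
  let p j := row4 (r j * cos (th j)) (r j * sin (th j)) (y j) (z j) in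
  row4 (A * cos (th i) - B * sin (th i)) (A * sin (th i) + B * cos (th i)) C D
    = \sum_(j | j != i) b j *: (p j - Q j *: p i) - K *: p i <->
  [/\ A = \sum_(j | j != i) b j * (r j * cos (th j - th i) - Q j * r i) - K * r i,
      B = \sum_(j | j != i) b j * (r j * sin (th j - th i)),
      C = \sum_(j | j != i) b j * (y j - Q j * y i) - K * y i &
      D = \sum_(j | j != i) b j * (z j - Q j * z i) - K * z i].
Proof.
move=> p.
set A' := \sum_(j | j != i) b j * (r j * cos _ - _) - _.
set B' := \sum_(j | j != i) b j * (r j * sin _).
set C' := _ - K * y i; set D' := _ - K * z i.
have thE j : th j = th i + (th j - th i) by ring.
have -> : \sum_(j | j != i) b j *: (p j - Q j *: p i) - K *: p i =
  row4 (A' * cos (th i) - B' * sin (th i)) (A' * sin (th i) + B' * cos (th i))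
    C' D'.
  apply/rowP => -[[|[|[|[|//]]]] hk]; rewrite !mxE summxE /=.
  - under eq_bigr do rewrite !mxE /= thE cosD.
    rewrite /A' /B' mulrBl !mulr_suml addrAC -sumrB -mulrA; congr (_ - _).
    by apply: eq_bigr => j _; ring.
  - under eq_bigr do rewrite !mxE /= thE sinD.
    rewrite /A' /B' mulrBl !mulr_suml addrAC -big_split -mulrA; congr (_ - _).
    by apply: eq_bigr => j _; rewrite /=; ring.
  - by under eq_bigr do rewrite !mxE /=.
  - by under eq_bigr do rewrite !mxE /=.
split=> [/row4P[e1 e2 -> ->]|[-> -> -> ->] //].
by have [-> ->] := rotation_inj e1 e2.
Qed.

(** * Kinematics of a curve of elliptic form *)

Section EllipticCurve.
Context (R : realType) (N : nat) (I : set R) (oI : open I).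
Context (a : 'I_N -> R) (alpha : R -> R) (r y z : 'I_N -> R -> R).
Hypothesis hcand : elliptic_candidate I alpha r y z.

Let curve := elliptic_curve a alpha r y z.

Definition elliptic_velocity i t : 'rV[R]_4 :=
  let th := alpha t + a i in
  let A := derive1 (r i) t in let B := r i t * derive1 alpha t in
  row4 (A * cos th - B * sin th) (A * sin th + B * cos th)
    (derive1 (y i) t) (derive1 (z i) t).

(** [A] and [B] are the radial and transverse accelerations of polar coordinates, with their
    centripetal and Coriolis terms. *)
Definition elliptic_acceleration i t : 'rV[R]_4 :=
  let th := alpha t + a i in
  let A := derive1n 2 (r i) t - r i t * derive1 alpha t ^+ 2 in
  let B := r i t * derive1n 2 alpha t + 2 * derive1 (r i) t * derive1 alpha t in
  row4 (A * cos th - B * sin th) (A * sin th + B * cos th)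
    (derive1n 2 (y i) t) (derive1n 2 (z i) t).

Lemma alpha_derive t : I t ->
  is_derive t 1 alpha (derive1 alpha t) /\
  is_derive t 1 (derive1 alpha) (derive1n 2 alpha t).
Proof. by case: hcand => h _ _ _ It; exact: (twice_derivable_onE h It). Qed.

Lemma radius_derive i t : I t ->
  is_derive t 1 (r i) (derive1 (r i) t) /\
  is_derive t 1 (derive1 (r i)) (derive1n 2 (r i) t).
Proof. by case: hcand => _ /(_ i)[h _ _] _ _ It; exact: (twice_derivable_onE h It). Qed.

Lemma y_derive i t : I t ->
  is_derive t 1 (y i) (derive1 (y i) t) /\
  is_derive t 1 (derive1 (y i)) (derive1n 2 (y i) t).
Proof. by case: hcand => _ /(_ i)[_ h _] _ _ It; exact: (twice_derivable_onE h It). Qed.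

Lemma z_derive i t : I t ->
  is_derive t 1 (z i) (derive1 (z i) t) /\
  is_derive t 1 (derive1 (z i)) (derive1n 2 (z i) t).
Proof. by case: hcand => _ /(_ i)[_ _ h] _ _ It; exact: (twice_derivable_onE h It). Qed.

Lemma is_derive_row4 (f0 f1 f2 f3 : R -> R) (t d0 d1 d2 d3 : R) :
  is_derive t 1 f0 d0 -> is_derive t 1 f1 d1 -> is_derive t 1 f2 d2 ->
  is_derive t 1 f3 d3 ->
  is_derive t 1 (fun s => row4 (f0 s) (f1 s) (f2 s) (f3 s)) (row4 d0 d1 d2 d3).
Proof.
move=> h0 h1 h2 h3; apply: is_derive_mx => i k; rewrite mxE.
by case: k => [[|[|[|[|//]]]] hk] /=;
   under eq_fun do rewrite mxE.
Qed.

(** The turning of the frame contributes [da] times the quarter turn [(- g, f)] of the components.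
    With [f] the radial velocity and [g] the transverse one, this produces the polar
    acceleration. *)
Lemma is_derive_rotated (f g : R -> R) (b t df dg da : R) :
  is_derive t 1 f df -> is_derive t 1 g dg -> is_derive t 1 alpha da ->
  is_derive t 1 (fun s => f s * cos (alpha s + b) - g s * sin (alpha s + b))
    ((df - g t * da) * cos (alpha t + b) - (dg + f t * da) * sin (alpha t + b)) /\
  is_derive t 1 (fun s => f s * sin (alpha s + b) + g s * cos (alpha s + b))
    ((df - g t * da) * sin (alpha t + b) + (dg + f t * da) * cos (alpha t + b)).
Proof.
move=> hf hg ha.
have hc := is_derive_cos_shift b ha; have hs := is_derive_sin_shift b ha.
split.
- apply: (is_derive_eq (is_derive_addfun (is_derive_mulfun hf hc)
    (is_derive_oppfun (is_derive_mulfun hg hs)))); ring.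
- apply: (is_derive_eq (is_derive_addfun (is_derive_mulfun hf hs)
    (is_derive_mulfun hg hc))); ring.
Qed.

Lemma elliptic_curve_derive i t :
  I t -> is_derive t 1 (curve i) (elliptic_velocity i t).
Proof.
move=> It; have [ha _] := alpha_derive It; have [hr _] := radius_derive i It.
have [hy _] := y_derive i It; have [hz _] := z_derive i It.
apply: is_derive_row4 => //.
- apply: (is_derive_eq (is_derive_mulfun hr (is_derive_cos_shift (a i) ha))); ring.
- apply: (is_derive_eq (is_derive_mulfun hr (is_derive_sin_shift (a i) ha))); ring.
Qed.

Lemma elliptic_velocity_derive i t :
  I t -> is_derive t 1 (elliptic_velocity i) (elliptic_acceleration i t).
Proof.
move=> It; have [ha1 ha2] := alpha_derive It; have [hr1 hr2] := radius_derive i It.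
have [_ hy] := y_derive i It; have [_ hz] := z_derive i It.
have [h1 h2] := is_derive_rotated (a i) hr2 (is_derive_mulfun hr1 ha2) ha1.
apply: is_derive_row4 => //.
- apply: (is_derive_eq h1).
  move: (cos _) (sin _) (r i t) (derive1 (r i) t) (derive1n 2 (r i) t)
    (derive1 alpha t) (derive1n 2 alpha t) => *; ring.
- apply: (is_derive_eq h2).
  move: (cos _) (sin _) (r i t) (derive1 (r i) t) (derive1n 2 (r i) t)
    (derive1 alpha t) (derive1n 2 alpha t) => *; ring.
Qed.

(** The common angle [alpha t] cancels in the difference of the phases, so only [a i - a j]
    survives. *)
Lemma dot_elliptic_curve i j t :
  dot (curve i t) (curve j t) = elliptic_q a r y z i j t.
Proof.
rewrite /curve /elliptic_curve -!/(row4 _ _ _ _) dot_row4 /elliptic_q.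
have -> : a i - a j = (alpha t + a i) - (alpha t + a j) by ring.
rewrite cosB; ring.
Qed.

Lemma constraint i t : I t -> r i t ^+ 2 + y i t ^+ 2 + z i t ^+ 2 = 1.
Proof. by case: hcand => _ _ _ h It; case: (h i t It). Qed.

Lemma dot_elliptic_curve_self i t : I t -> dot (curve i t) (curve i t) = 1.
Proof.
move=> It; rewrite dot_elliptic_curve /elliptic_q subrr cos0 mulr1 -!expr2.
exact: constraint.
Qed.

Lemma dot_elliptic_velocity i t :
  dot (elliptic_velocity i t) (elliptic_velocity i t) =
  derive1 (r i) t ^+ 2 + r i t ^+ 2 * derive1 alpha t ^+ 2
  + derive1 (y i) t ^+ 2 + derive1 (z i) t ^+ 2.
Proof.
rewrite dot_row4; set c := cos _; set s := sin _.
have cs : c ^+ 2 + s ^+ 2 = 1 := cos2Dsin2 _.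
move: c s (derive1 (r i) t) (derive1 alpha t) (derive1 (y i) t)
  (derive1 (z i) t) cs => c s dr da dy dz cs.
(* Inserting [c ^+ 2 + s ^+ 2] for the factor 1 in the planar terms leaves a polynomial identity. *)
rewrite -[dr ^+ 2]mulr1 -[_ * da ^+ 2]mulr1 -cs; ring.
Qed.

(** The velocity is tangent to the sphere: this is half the derivative of the constraint. *)
Lemma constraint_derive i t : I t ->
  r i t * derive1 (r i) t + y i t * derive1 (y i) t + z i t * derive1 (z i) t = 0.
Proof.
move=> It; have [hr _] := radius_derive i It.
have [hy _] := y_derive i It; have [hz _] := z_derive i It.
have h := is_derive_addfun (is_derive_addfun (is_derive_mulfun hr hr)
  (is_derive_mulfun hy hy)) (is_derive_mulfun hz hz).
have n2 : (2 : R) != 0 by rewrite pnatr_eq0.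
apply: (mulfI n2); rewrite mulr0 -[RHS](derive_const_on (c := 1) oI It _ h).
  ring.
by move=> s Is; rewrite -!expr2 constraint.
Qed.

Lemma constraint_derive2 i t : I t ->
  r i t * derive1n 2 (r i) t + derive1 (r i) t ^+ 2
  + (y i t * derive1n 2 (y i) t + derive1 (y i) t ^+ 2)
  + (z i t * derive1n 2 (z i) t + derive1 (z i) t ^+ 2) = 0.
Proof.
move=> It; have [hr hr2] := radius_derive i It.
have [hy hy2] := y_derive i It; have [hz hz2] := z_derive i It.
have h := is_derive_addfun (is_derive_addfun (is_derive_mulfun hr hr2)
  (is_derive_mulfun hy hy2)) (is_derive_mulfun hz hz2).
(* The function differentiated here is the left-hand side of [constraint_derive], which is 0
   throughout [I]. *)
rewrite -[RHS](derive_const_on (c := 0) oI It _ h); last first.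
  by move=> s Is; rewrite constraint_derive.
move: (derive1 (r i) t) (derive1 (y i) t) (derive1 (z i) t)
  (derive1n 2 (r i) t) (derive1n 2 (y i) t) (derive1n 2 (z i) t) => *; ring.
Qed.

End EllipticCurve.

(** The diagonal terms vanish by antisymmetry, so they may be added; exchanging the summations then
    shows that the full double sum is its own negative. *)
Lemma antisymmetric_sum0 (R : realType) (N : nat) (f : 'I_N -> 'I_N -> R) :
  (forall i j, f i j = - f j i) -> \sum_i \sum_(j | j != i) f i j = 0.
Proof.
move=> anti.
have self0 x : x = - x -> x = 0 :> R by lra.
have -> : \sum_i \sum_(j | j != i) f i j = \sum_i \sum_j f i j.
  apply: eq_bigr => i _; rewrite [RHS](bigD1 i) //=.
  by rewrite (self0 (f i i)) ?add0r.
apply: self0; rewrite [LHS]exchange_big /= -sumrN; apply: eq_bigr => j _.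
by rewrite -sumrN; apply: eq_bigr.
Qed.

Lemma elliptic_qC (R : realType) (N : nat) (a : 'I_N -> R)
    (r y z : 'I_N -> R -> R) i j t :
  elliptic_q a r y z i j t = elliptic_q a r y z j i t.
Proof. by rewrite /elliptic_q -cosN opprB; ring. Qed.

(** * Components of the equation of motion *)

Section EllipticSolutions.
Context (R : realType) (N : nat) (m : 'I_N -> R) (I : set R) (oI : open I).
Context (a : 'I_N -> R) (alpha : R -> R) (r y z : 'I_N -> R -> R).
Hypothesis hcand : elliptic_candidate I alpha r y z.

Let curve := elliptic_curve a alpha r y z.
Let q := elliptic_q a r y z.
(** The squared norm of the velocity, in the form given by [dot_elliptic_velocity]. *)
Let speed2 i t := derive1 (r i) t ^+ 2 + r i t ^+ 2 * derive1 alpha t ^+ 2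
  + derive1 (y i) t ^+ 2 + derive1 (z i) t ^+ 2.

Definition radial_eq i t :=
  derive1n 2 (r i) t - r i t * derive1 alpha t ^+ 2 =
  \sum_(j | j != i) m j * (r j t * cos (a j - a i) - q i j t * r i t)
                      / grav_den (q i j t) - speed2 i t * r i t.

Definition angular_eq i t :=
  r i t * derive1n 2 alpha t + 2 * derive1 (r i) t * derive1 alpha t =
  \sum_(j | j != i) m j * r j t * sin (a j - a i) / grav_den (q i j t).

(** To be read with [x] equal to [y] or [z], the coordinates of the plane that the rotation
    fixes. *)
Definition fixed_plane_eq (x : 'I_N -> R -> R) i t :=
  derive1n 2 (x i) t =
  \sum_(j | j != i) m j * (x j t - q i j t * x i t) / grav_den (q i j t)
  - speed2 i t * x i t.

Lemma twice_derivable_elliptic_curve i :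
  [/\ twice_derivable_on I (curve i),
      forall t, I t -> derive1 (curve i) t = elliptic_velocity a alpha r y z i t &
      forall t, I t ->
        derive1n 2 (curve i) t = elliptic_acceleration a alpha r y z i t].
Proof.
by apply: (twice_derivable_onP oI) => t It;
   [exact: elliptic_curve_derive hcand _ _ _ | exact: elliptic_velocity_derive hcand _ _ _].
Qed.

Lemma elliptic_curve_newtonP i t : I t ->
  derive1n 2 (curve i) t =
    \sum_(j | j != i) (m j / grav_den (dot (curve i t) (curve j t))) *:
       (curve j t - dot (curve i t) (curve j t) *: curve i t)
    - dot (derive1 (curve i) t) (derive1 (curve i) t) *: curve i t <->
  [/\ radial_eq i t, angular_eq i t, fixed_plane_eq y i t & fixed_plane_eq z i t].
Proof.
move=> It; have [_ -> // -> //] := twice_derivable_elliptic_curve i.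
rewrite dot_elliptic_velocity -/(speed2 i t).
under eq_bigr do rewrite dot_elliptic_curve -/(q i _ t).
have thE j : a j - a i = alpha t + a j - (alpha t + a i) by ring.
pose b j := m j / grav_den (q i j t).
have sumE (g : 'I_N -> R) : \sum_(j | j != i) m j * g j / grav_den (q i j t)
    = \sum_(j | j != i) b j * g j.
  by apply: eq_bigr => j _; rewrite mulrAC.
have angE : \sum_(j | j != i) m j * r j t * sin (a j - a i) / grav_den (q i j t)
    = \sum_(j | j != i) b j * (r j t * sin (alpha t + a j - (alpha t + a i))).
  by rewrite -sumE; apply: eq_bigr => j _; rewrite thE mulrA.
have radE : \sum_(j | j != i) m j * (r j t * cos (a j - a i) - q i j t * r i t)
      / grav_den (q i j t)
    = \sum_(j | j != i) b j *
        (r j t * cos (alpha t + a j - (alpha t + a i)) - q i j t * r i t).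
  by rewrite -sumE; apply: eq_bigr => j _; rewrite thE.
rewrite /radial_eq /angular_eq /fixed_plane_eq radE angE.
rewrite (sumE (fun j => y j t - q i j t * y i t)).
rewrite (sumE (fun j => z j t - q i j t * z i t)).
exact: (elliptic_newtonP b (q i ^~ t) (fun j => alpha t + a j) (r ^~ t)
  (y ^~ t) (z ^~ t)).
Qed.

Lemma radius_neq0 i t : F_defined_on I y z -> I t -> r i t != 0.
Proof.
move=> hF It; apply: contra_neq (hF i t It) => r0.
by rewrite -(constraint hcand i It) r0; ring.
Qed.

(* The component along the position vector is automatic: its dot product with
   the equation of motion is the second derivative of the constraint. *)
Lemma radial_eq_of_fixed_plane i t : I t -> r i t != 0 ->
  fixed_plane_eq y i t -> fixed_plane_eq z i t -> radial_eq i t.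
Proof.
move=> It r0 hy hz; apply: (mulfI r0).
set A := \sum_(j | j != i) _.
have c2 := constraint_derive2 oI hcand i It.
have c0 := constraint hcand i It.
rewrite hy hz in c2.
set C := \sum_(j | j != i) _ in c2; set D := \sum_(j | j != i) _ in c2.
(* The gravitational force is orthogonal to the position: each [j] contributes a multiple of
   [q i j t] minus [q i j t] times the squared norm of the position, which is 1. *)
have : r i t * A + y i t * C + z i t * D = 0.
  rewrite !mulr_sumr -!big_split big1 // => j _ /=.
  have -> : a j - a i = - (a i - a j) by rewrite opprB.
  rewrite cosN; set g := grav_den _.
  have qE : q i j t = r i t * r j t * cos (a i - a j) + y i t * y j t + z i t * z j t by [].
  set k := cos _ in qE *.
  transitivity (m j / g * (r i t * r j t * k + y i t * y j t + z i t * z j t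
    - q i j t * (r i t ^+ 2 + y i t ^+ 2 + z i t ^+ 2))); first ring.
  by rewrite c0 mulr1 qE subrr mulr0.
move=> hs.
(* This matches the constraint-force terms in [c2] with the squared first derivatives there; what
   remains is linear in the products that occur. *)
have : speed2 i t * (r i t ^+ 2 + y i t ^+ 2 + z i t ^+ 2) = speed2 i t by rewrite c0 mulr1.
rewrite {2}/speed2 => hK.
lra.
Qed.

(** By the angle law the second term of [elliptic_F] is [r ^+ 2 * alpha' ^+ 2]. For the first,
    tangency gives [r * r' = - (y * u + z * v)], and the identity [(y * u + z * v) ^+ 2 + (y * v - z
    * u) ^+ 2 = (y ^+ 2 + z ^+ 2) * (u ^+ 2 + v ^+ 2)] with [y ^+ 2 + z ^+ 2 = 1 - r ^+ 2] yields
    [r' ^+ 2 + u ^+ 2 + v ^+ 2] after division by [r ^+ 2]. *)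
Lemma elliptic_F_speed (c : R) i t :
  F_defined_on I y z -> I t ->
  derive1 alpha t = c / \sum_j m j * r j t ^+ 2 ->
  elliptic_F m c i (y ^~ t) (z ^~ t) (derive1 (y i) t) (derive1 (z i) t)
  = speed2 i t.
Proof.
move=> hF It ha; have r0 := radius_neq0 i hF It.
have r2 j : 1 - y j t ^+ 2 - z j t ^+ 2 = r j t ^+ 2.
  by rewrite -(constraint hcand j It); ring.
have c1 := constraint_derive oI hcand i It.
rewrite /elliptic_F /speed2 r2; under eq_bigr do rewrite r2.
rewrite ha expr_div_n; set S := \sum_j _.
have -> : (derive1 (y i) t ^+ 2 + derive1 (z i) t ^+ 2
    - (y i t * derive1 (z i) t - z i t * derive1 (y i) t) ^+ 2) / r i t ^+ 2
    = derive1 (r i) t ^+ 2 + derive1 (y i) t ^+ 2 + derive1 (z i) t ^+ 2.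
  apply: (canLR (mulfK _)); first by rewrite expf_neq0.
  move: (derive1 (r i) t) (derive1 (y i) t) (derive1 (z i) t) c1 => dr u v c1.
  have e : (r i t * dr) ^+ 2 = (y i t * u + z i t * v) ^+ 2.
    by rewrite (_ : r i t * dr = - (y i t * u + z i t * v)) ?sqrrN //; lra.
  rewrite mulrDl mulrDl -[dr ^+ 2 * _]mulrC -exprMn e -r2; ring.
ring.
Qed.

(** * Conservation of angular momentum and the angle law *)

Lemma angular_momentum_derive t : I t ->
  (forall i, angular_eq i t) ->
  is_derive t 1 (fun s => \sum_i m i * (r i s * r i s * derive1 alpha s)) 0.
Proof.
move=> It hang; have [_ ha] := alpha_derive hcand It.
have hi i : is_derive t 1 (fun s => m i * (r i s * r i s * derive1 alpha s))
    (m i * r i t * (r i t * derive1n 2 alpha t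
                    + 2 * derive1 (r i) t * derive1 alpha t)).
  have [hr _] := radius_derive hcand i It.
  apply: (is_derive_eq (is_derive_mulfun (is_derive_cst (m i) t 1)
    (is_derive_mulfun (is_derive_mulfun hr hr) ha))).
  rewrite /cst; ring.
have hs := is_derive_sum hi.
rewrite (_ : (fun s => _) = \sum_(i < N) (fun s => m i * (r i s * r i s * derive1 alpha s))).
  apply: (is_derive_eq hs).
  under eq_bigr do rewrite hang mulr_sumr.
  (* The torques of a pair cancel because the sine is odd while [q i j] and the product of masses
     and radii are symmetric. *)
  apply: antisymmetric_sum0 => i j.
  rewrite -[a j - a i]opprB sinN /q elliptic_qC; ring.
by apply/funext => s; rewrite fct_sumE.
Qed.

Lemma moment_of_inertia_gt0 t : (0 < N)%N -> (forall i, 0 < m i) ->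
  F_defined_on I y z -> I t -> 0 < \sum_j m j * r j t ^+ 2.
Proof.
move=> N0 m0 hF It; rewrite (bigD1 (Ordinal N0)) //=.
apply: ltr_wpDr.
  by apply: sumr_ge0 => j _; rewrite mulr_ge0 ?sqr_ge0 // ltW.
by rewrite mulr_gt0 // lt0r sqr_ge0 expf_neq0 // (radius_neq0 _ hF).
Qed.

Lemma angle_law_of_solution : is_interval I -> I !=set0 -> (0 < N)%N ->
  (forall i, 0 < m i) -> F_defined_on I y z ->
  (forall i t, I t -> angular_eq i t) ->
  exists2 c : R, c != 0 & elliptic_angle_law I m c alpha r.
Proof.
move=> iI [t0 It0] N0 m0 hF hang.
pose L s := \sum_i m i * (r i s * r i s * derive1 alpha s).
have cL : is_const_on I L.
  apply: derive0_const_on => // t It.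
  by apply: angular_momentum_derive => // i; exact: hang.
have law t : I t -> is_derive t 1 alpha (L t0 / \sum_j m j * r j t ^+ 2).
  move=> It; have S0 := moment_of_inertia_gt0 N0 m0 hF It.
  have [ha _] := alpha_derive hcand It.
  apply: (is_derive_eq ha).
  apply: (canRL (mulfK _)); first by rewrite gt_eqF.
  rewrite (cL _ _ It0 It) mulr_sumr; apply: eq_bigr => i _; ring.
(* The constant [c] is the conserved angular momentum, evaluated at an arbitrary point of [I]. *)
exists (L t0) => //.
(* If [c] were 0, the angle law would give [alpha] a zero derivative on the interval and make it
   constant, which a candidate excludes. *)
apply/eqP => L0; case: hcand => _ _ + _; apply.
by apply: derive0_const_on => // t /law; rewrite L0 mul0r.
Qed.

(** * Passage between the equations of motion and the first-order system *)

Lemma elliptic_system_of_solution (c : R) :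
  F_defined_on I y z -> elliptic_angle_law I m c alpha r ->
  solves_curved_nbody I m curve -> elliptic_system I m a c alpha r y z.
Proof.
move=> hF hlaw [_ _ hns hode]; split=> //.
  by move=> i j t ij It; rewrite -(dot_elliptic_curve a alpha); exact: hns.
exists (fun i => derive1 (y i)), (fun i => derive1 (z i)) => i t It /=.
have /(elliptic_curve_newtonP i It)[_ hang hy hz] := hode i t It.
(* Once [elliptic_F] is recognized as the squared speed, the equations for [u] and [v] are those of
   the fixed plane. *)
rewrite (elliptic_F_speed i hF It (derive1_is_derive (hlaw t It))).
have [hy1 hy2] := y_derive hcand i It; have [hz1 hz2] := z_derive hcand i It.
split; [exact: hy1 | exact: hz1 | | | exact: hang].
  by have := hy2; rewrite hy.
by have := hz2; rewrite hz.
Qed.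

(** The system has no radial equation; it is recovered from the [y] and [z] equations and the
    constraint, the radius being nonzero by the clause [F_defined_on] of the system. *)
Lemma solution_of_elliptic_system (c : R) :
  elliptic_angle_law I m c alpha r -> elliptic_system I m a c alpha r y z ->
  solves_curved_nbody I m curve.
Proof.
move=> hlaw [hns hF [u [v huv]]]; split.
- by move=> i; case: (twice_derivable_elliptic_curve i).
- by move=> i t; exact: dot_elliptic_curve_self.
- by move=> i j t ij It; rewrite dot_elliptic_curve; exact: hns.
move=> i t It; apply/(elliptic_curve_newtonP i It).
(* The auxiliary [u] and [v] are known to be the velocities only on [I]; as [I] is open, their
   derivatives at [t] are still the second derivatives of [y i] and [z i]. *)
have uE s : I s -> u i s = derive1 (y i) s.
  by move=> Is; case: (huv i s Is) => /derive1_is_derive.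
have vE s : I s -> v i s = derive1 (z i) s.
  by move=> Is; case: (huv i s Is) => _ /derive1_is_derive.
have [_ _ hu hv hang] := huv i t It.
rewrite (uE t It) (vE t It) in hu hv.
rewrite (elliptic_F_speed i hF It (derive1_is_derive (hlaw t It))) in hu hv.
have hy : fixed_plane_eq y i t.
  rewrite /fixed_plane_eq derive1nS derive1n1.
  exact: derive1_is_derive (is_derive_eq_on oI It uE hu).
have hz : fixed_plane_eq z i t.
  rewrite /fixed_plane_eq derive1nS derive1n1.
  exact: derive1_is_derive (is_derive_eq_on oI It vE hv).
split=> //; exact: radial_eq_of_fixed_plane It (radius_neq0 i hF It) hy hz.
Qed.

End EllipticSolutions.

(** The equivalence is stated where the quotients in [elliptic_F] make sense; in the second claim
    this condition is already contained in [elliptic_system]. *)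
Theorem mainTheorem3 (R : realType) (N : nat) (hN : (2 <= N)%N)
    (m : 'I_N -> R) (hm : forall i, 0 < m i)
    (I : set R) (hI : is_open_interval I)
    (a : 'I_N -> R) (alpha : R -> R) (r y z : 'I_N -> R -> R)
    (hcand : elliptic_candidate I alpha r y z) :
  [/\ F_defined_on I y z ->
      (positive_elliptic_rotopulsator I m (elliptic_curve a alpha r y z) <->
       exists c : R,
         [/\ c != 0,
             elliptic_angle_law I m c alpha r,
             exists i j, i != j /\ ~ is_const_on I (elliptic_q a r y z i j) &
             elliptic_system I m a c alpha r y z]),
      (exists c : R,
         [/\ c != 0,
             elliptic_angle_law I m c alpha r,
             forall i j, i != j -> is_const_on I (elliptic_q a r y z i j) &
             elliptic_system I m a c alpha r y z]) ->
      positive_elliptic_relative_equilibrium I m (elliptic_curve a alpha r y z) &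
      forall (i j : 'I_N) (t : R), i != j -> I t ->
        elliptic_q a r y z i j t = 1 \/ elliptic_q a r y z i j t = -1 ->
        ~ positive_elliptic_rotopulsator I m (elliptic_curve a alpha r y z) /\
        ~ positive_elliptic_relative_equilibrium I m
            (elliptic_curve a alpha r y z)].
Proof.
have [oI iI nI] := hI.
have form : positive_elliptic_form I (elliptic_curve a alpha r y z).
  by exists a, alpha, r, y, z.
have dotE i j : (fun t => dot (elliptic_curve a alpha r y z i t)
    (elliptic_curve a alpha r y z j t)) = elliptic_q a r y z i j.
  by apply/funext => t; exact: dot_elliptic_curve.
split.
- move=> hF; split=> [[sol _ [i [j [ij nc]]]]|[c [c0 law [i [j [ij nc]]] sys]]].
    have [c c0 law] : exists2 c : R, c != 0 & elliptic_angle_law I m c alpha r.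
      apply: (@angle_law_of_solution _ _ m _ a _ _ _ _ hcand iI nI _ hm hF).
        exact: ltnW.
      move=> k t It; case: sol => _ _ _ /(_ k t It).
      by case/(elliptic_curve_newtonP m oI a hcand k It).
    exists c; split=> //; last exact: elliptic_system_of_solution sol.
    by exists i, j; rewrite -dotE.
  split=> //; first exact: solution_of_elliptic_system law sys.
  by exists i, j; rewrite dotE.
- move=> [c [c0 law cst_q sys]]; split=> //.
    exact: solution_of_elliptic_system law sys.
  by move=> i j ij; rewrite dotE; exact: cst_q.
- move=> i j t ij It q1.
  (* At such a time [1 - q ^+ 2] vanishes, contrary to the nonsingularity clause in the definition
     of a solution; both kinds of motion include that clause. *)
  have nsol : ~ solves_curved_nbody I m (elliptic_curve a alpha r y z).
    move=> [_ _ /(_ i j t ij It) + _]; rewrite dot_elliptic_curve.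
    by case: q1 => ->; rewrite ?sqrrN expr1n subrr eqxx.
  by split=> -[].
Qed.
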